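(* Let $q\in(0,1)$. In general $\nabla^{(\mu)}_q\cdot\nabla^{(\nu)}_q\neq\nabla^{(\mu+\nu)}_q$ for $\mu,\nu\in\mathbb{R}$; that is, there exist $\mu,\nu\in\mathbb{R}$ such that the composition $\nabla^{(\mu)}_q\circ\nabla^{(\nu)}_q$ and the operator $\nabla^{(\mu+\nu)}_q$ are different as operators on $\omega$.
   Context: $\mathbb{Z}^+_0=\{0,1,2,\dots\}$, and $\omega$ is the complex vector space of all sequences $g=(g_j)_{j\in\mathbb{Z}^+_0}$ of complex numbers, with the convention $g_j=0$ for $j<0$. For real $x$, $[x]_q=\frac{1-q^x}{1-q}$; $[0]_q!=1$ and $[k]_q!=\prod_{i=1}^k[i]_q$. For real $\mu$ the $q$-difference operator of order $\mu$ is $$(\nabla^{(\mu)}_q g)_j=\sum_{k=0}^{\infty}(-1)^k q^{\binom{k}{2}}\frac{\Gamma_q(\mu+1)}{[k]_q!\,\Gamma_q(\mu-k+1)}\,g_{j-k}\qquad(j\in\mathbb{Z}^+_0),$$ where $\Gamma_q$ is the $q$-gamma function and the quotient $\Gamma_q(\mu+1)/\Gamma_q(\mu-k+1)$ means the product $\prod_{i=0}^{k-1}[\mu-i]_q$ (empty product $=1$). The sum is finite since $g_{j-k}=0$ for $k>j$. *)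

(* Defs.v *)
From mathcomp Require Import all_boot all_order all_algebra.
From mathcomp Require Import all_classical all_reals all_analysis.
From mathcomp.real_closed Require Import complex.

Set Implicit Arguments.
Unset Strict Implicit.
Unset Printing Implicit Defensive.

Import Order.TTheory GRing.Theory Num.Theory.

Local Open Scope ring_scope.
Local Open Scope complex_scope.

Definition omega (R : realType) : Type := nat -> R[i].

Definition zext (R : realType) (g : omega R) (z : int) : R[i] :=
  match z with
  | Posz n => g n
  | Negz _ => 0
  end.

Definition qnum (R : realType) (q x : R) : R := (1 - q `^ x) / (1 - q).

Definition qfact (R : realType) (q : R) (k : nat) : R :=
  \prod_(1 <= i < k.+1) qnum q i%:R.

(* The quotient Gamma_q(mu + 1) / Gamma_q(mu - k + 1), read as a product so
   that it also makes sense at the poles of Gamma_q. *)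
Definition qgamma_quotient (R : realType) (q mu : R) (k : nat) : R :=
  \prod_(0 <= i < k) qnum q (mu - i%:R).

Definition nabla_coef (R : realType) (q mu : R) (k : nat) : R :=
  (-1) ^+ k * q ^+ 'C(k, 2) * (qgamma_quotient q mu k / qfact q k).

(* The sum over all k : nat is a finitely supported sum: its terms vanish for
   k > j because zext g is zero on negative integers. *)
Definition nabla (R : realType) (q mu : R) (g : omega R) : omega R :=
  fun j : nat =>
    \sum_(k \in [set: nat]%classic)
      (nabla_coef q mu k)%:C * zext g (j%:Z - k%:Z).

Lemma nablaE (R : realType) (q mu : R) (g : omega R) (j : nat) :
  nabla q mu g j = \sum_(k < j.+1) (nabla_coef q mu k)%:C * g (j - k)%N.
Proof.
rewrite /nabla -(fsbig_widen `I_j.+1) //=; last first.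
  move=> k [_ /= /negP]; rewrite -leqNgt => jk.
  suff -> : zext g (j%:Z - k%:Z) = 0 by rewrite mulr0.
  by rewrite -opprB subzn ?(ltnW jk)//; case: (k - j)%N (subn_gt0 j k) => [|n]//; rewrite jk.
rewrite -fsbig_ord.
by apply: eq_bigr => k _; rewrite subzn// -ltnS.
Qed.

(* Main.v *)
Require Import Defs.
From mathcomp Require Import all_boot all_order all_algebra.
From mathcomp Require Import all_classical all_reals all_analysis.
From mathcomp.real_closed Require Import complex.
Import Order.TTheory GRing.Theory Num.Theory.
Local Open Scope ring_scope.

(** Both sides are lower triangular Toeplitz operators, so they are determined
    by their value on the unit impulse at the origin, which is the sequence of
    coefficients; composing two of them convolves these sequences. The
    coefficient of index 0 is 1 whatever [mu] is, so it cannot tell the two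
    sides apart, and it makes the coefficient of index 1, which is
    [- qnum q mu], add up under convolution. But [qnum q] is not additive when
    [0 < q < 1]: [qnum q 1 + qnum q 1 = 2], whereas [qnum q 2 = 1 + q]. Hence
    already [mu = nu = 1] separates the two operators, at index 1 of the image
    of the impulse. *)

Definition impulse (R : realType) : omega R := fun j => (j == 0%N)%:R.

Lemma nabla_impulse (R : realType) (q mu : R) (j : nat) :
  nabla q mu (impulse R) j = (nabla_coef q mu j)%:C%C.
Proof.
rewrite nablaE big_ord_recr /= subnn mulr1 big1 ?add0r// => k _.
by rewrite /impulse subn_eq0 leqNgt ltn_ord mulr0.
Qed.

Lemma nabla_coef0 (R : realType) (q mu : R) : nabla_coef q mu 0 = 1.
Proof.
by rewrite /nabla_coef /qgamma_quotient /qfact !big_geq// expr0 !mul1r invr1.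
Qed.

Lemma qnum1 (R : realType) (q : R) : 0 < q -> q < 1 -> qnum q 1 = 1.
Proof.
by move=> q0 q1; rewrite /qnum powRr1 ?(ltW q0)// divff// subr_eq0 gt_eqF.
Qed.

Lemma qnum2 (R : realType) (q : R) : 0 < q -> q < 1 -> qnum q 2 = 1 + q.
Proof.
move=> q0 q1; rewrite /qnum powR_mulrn ?(ltW q0)// -[X in X - _](expr1n _ 2).
by rewrite subr_sqr mulrAC divff ?mul1r// subr_eq0 gt_eqF.
Qed.

Lemma nabla_coef1 (R : realType) (q mu : R) : 0 < q -> q < 1 ->
  nabla_coef q mu 1 = - qnum q mu.
Proof.
move=> q0 q1; rewrite /nabla_coef /qgamma_quotient /qfact !big_nat1 subr0.
by rewrite qnum1// bin_small// expr0 expr1 mulr1 divr1 mulN1r.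
Qed.

(** Convolving two sequences that both start with 1 adds their entries of
    index 1. *)
Lemma nabla_comp_impulse1 (R : realType) (q mu nu : R) : 0 < q -> q < 1 ->
  nabla q mu (nabla q nu (impulse R)) 1%N =
  (- (qnum q mu + qnum q nu))%:C%C.
Proof.
move=> q0 q1; rewrite nablaE !big_ord_recl big_ord0 addr0 /= !nabla_impulse.
rewrite !nabla_coef0 !nabla_coef1// mul1r mulr1 -rmorphD /=.
by rewrite addrC opprD.
Qed.

Theorem theorem2p2 (R : realType) (q : R) (hq0 : 0 < q) (hq1 : q < 1) :
  exists mu nu : R, nabla q mu \o nabla q nu <> nabla q (mu + nu).
Proof.
exists 1, 1 => /(congr1 (fun T => T (impulse R) 1%N)) /=.
rewrite nabla_comp_impulse1// nabla_impulse nabla_coef1//.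
move=> /complexI /oppr_inj; rewrite qnum1// qnum2// => /addrI q_eq1.
by rewrite -q_eq1 ltxx in hq1.
Qed.
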